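(* Suppose there exist real numbers $0<\alpha<\frac{1}{2}$ and $\delta>0$ such that $$\sum_{1\le j\le m^{\alpha}}\left\{\pi\!\left(\frac{m+m^{\alpha}}{j}\right)-\pi\!\left(\frac{m}{j}\right)\right\}\ge \delta m^{\alpha}$$ holds for all sufficiently large $m$ (the sum over positive integers $j$). Then, with $$\gamma=\max\!\left(\alpha,\ \frac{1-\delta(1-\alpha)}{2-\delta}\right),$$ we have $\gamma<\frac{1}{2}$ and $g_1(n)<n^{\gamma}$ for all sufficiently large integers $n$.
   Context: $\pi(x)$ is the number of primes $\le x$. For an integer $\nu>1$, $\omega(\nu)$ is the number of distinct prime divisors of $\nu$, and $\omega(1)=0$. $g_1(n)$ is the largest positive integer $k$ such that $\omega\big(\prod_{i=1}^{l}(n+i)\big)\ge l$ for all $1\le l\le k$. *)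

(* Defs.v *)
From Stdlib Require Import Reals ZArith.
From mathcomp Require Import all_boot.

(* floor of a real, as a nat (0 for negative reals) *)
Definition nfloor (x : R) : nat := Z.to_nat (Int_part x).

Definition primepi (x : R) : nat := count prime (iota 1 (nfloor x)).

Definition omega (n : nat) : nat := size (primes n).

Definition g1_cond (n k : nat) : Prop :=
  forall l : nat, (1 <= l)%N -> (l <= k)%N ->
    (l <= omega (\prod_(1 <= i < l.+1) (n + i)))%N.

Definition is_g1 (n k : nat) : Prop :=
  (1 <= k)%N /\ g1_cond n k /\
  (forall k' : nat, (1 <= k')%N -> g1_cond n k' -> (k' <= k)%N).

(* the sum over 1 <= j <= m^alpha of pi((m+m^alpha)/j) - pi(m/j).
   Each term is nonnegative (pi is monotone), so truncated nat subtraction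
   is exact. *)
Definition prime_sum (alpha : R) (m : nat) : nat :=
  \sum_(1 <= j < (nfloor (Rpower (INR m) alpha)).+1)
     (primepi (Rdiv (Rplus (INR m) (Rpower (INR m) alpha)) (INR j))
      - primepi (Rdiv (INR m) (INR j))).

(* Main.v *)
Require Import Defs.
From Stdlib Require Import Reals ZArith Lra.
From HB Require Import structures.
From mathcomp Require Import all_boot.
From mathcomp Require Import zify.
Local Open Scope R_scope.

(** Let [L = floor (n^gamma)] and suppose that [(n+1)...(n+L) = L! C(n+L, L)] has
    at least [L] distinct prime divisors. Those exceeding [L] all divide
    [C(n+L, L)], so their logarithms add up to at most [L (ln (n+L) - ln L + 1)].
    Covering [(n, n+L]] by intervals [(m, m + m^alpha]], the hypothesis provides
    about [delta L] of them of size at least [n^(1-alpha)]. By Chebyshev's bound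
    only [O(L / ln L)] primes are at most [L], and only [o(L)] are at most [A L] for
    a fixed [A], so nearly all of the remaining [(1-delta) L] exceed [A L].
    Comparing both estimates, the multiples of [L ln n] cancel by the choice of
    [gamma], which leaves [(1 - delta) ln A = O(1)], false for large [A].
    That [delta < 1] follows from the same count of large primes with
    [L = floor (n^(1/2))]; then [alpha < gamma], so the maximum with [alpha] is idle. *)

(** * Logarithms of natural numbers *)

HB.instance Definition _ := Monoid.isComLaw.Build R 0 Rplus
  (fun x y z => esym (Rplus_assoc x y z)) Rplus_comm Rplus_0_l.

Lemma INR_addn m n : INR (m + n)%N = INR m + INR n.
Proof. exact: plus_INR. Qed.

Lemma INR_muln m n : INR (m * n)%N = INR m * INR n.
Proof. exact: mult_INR. Qed.

Lemma INR_leq m n : (m <= n)%N -> INR m <= INR n.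
Proof. by move=> /leP; exact: le_INR. Qed.

Lemma INR_ltn m n : (m < n)%N -> INR m < INR n.
Proof. by move=> /ltP; exact: lt_INR. Qed.

Lemma INR_gt0 n : (0 < n)%N -> 0 < INR n.
Proof. exact: INR_ltn. Qed.

Lemma ln_le x y : 0 < x -> x <= y -> ln x <= ln y.
Proof.
move=> x0 [lt_xy | <-]; last exact: Rle_refl.
exact/Rlt_le/ln_increasing.
Qed.

(** [ln] takes the default value 0 at 0, which lets the next two lemmas include the natural number
    0. *)
Lemma ln_0 : ln 0 = 0.
Proof.
by unfold ln; case: Rlt_dec => // lt00; case: (Rlt_irrefl _ lt00).
Qed.

Lemma ln_INR_ge0 n : 0 <= ln (INR n).
Proof.
case: n => [|n]; first by rewrite ln_0; apply: Rle_refl.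
by rewrite -ln_1; apply: ln_le; [lra | apply: (INR_leq 1)].
Qed.

Lemma ln_INR_leq m n : (m <= n)%N -> ln (INR m) <= ln (INR n).
Proof.
case: m => [|m] le_mn.
  by rewrite ln_0; exact: ln_INR_ge0.
by apply: ln_le; [exact: INR_gt0 | exact: INR_leq].
Qed.

Lemma ln_le_sub1 y : 0 < y -> ln y <= y - 1.
Proof.
move=> y0; have := exp_ineq1_le (ln y); rewrite exp_ln //; lra.
Qed.

(** Stirling's lower bound [n! >= (n/e)^n]. The induction step reduces to [n ln (1 + 1/n) <= 1],
    which is [ln y <= y - 1] at [y = (n+1)/n]. *)
Lemma ln_fact_ge n : INR n * ln (INR n) - INR n <= ln (INR n`!).
Proof.
elim: n => [|n IHn]; first by rewrite /= ln_1; lra.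
have n1_gt0 : 0 < INR n.+1 by exact: INR_gt0.
rewrite factS INR_muln ln_mult //; last exact/INR_gt0/fact_gt0.
case: n => [|n] in IHn n1_gt0 *; first by rewrite /= ln_1; lra.
have n_gt0 : 0 < INR n.+1 by exact: INR_gt0.
have step : INR n.+1 * (ln (INR n.+2) - ln (INR n.+1)) <= 1.
  have q_gt0 := Rdiv_lt_0_compat _ _ n1_gt0 n_gt0.
  rewrite (_ : INR n.+2 = INR n.+1 * (INR n.+2 / INR n.+1)); last by field; lra.
  rewrite ln_mult // Rplus_minus_l.
  have := ln_le_sub1 _ q_gt0.
  move=> /(Rmult_le_compat_l (INR n.+1) _ _ (Rlt_le _ _ n_gt0)).
  rewrite (_ : INR n.+1 * (INR n.+2 / INR n.+1 - 1) = INR n.+2 - INR n.+1); last by field; lra.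
  rewrite (S_INR n.+1); lra.
rewrite (S_INR n.+1) in step n1_gt0 *; nra.
Qed.

(** * Factorials, binomial coefficients and their prime divisors *)

Lemma prod_shift_bin n l :
  \prod_(1 <= i < l.+1) (n + i) = ('C(n + l, l) * l`!)%N.
Proof.
apply/eqP; rewrite -(eqn_pmul2r (fact_gt0 n)); apply/eqP.
rewrite -mulnA -[X in (_ * (_ * X`!))%N](addnK l n) bin_fact ?leq_addl //.
elim: l => [|l IHl]; first by rewrite big_geq // mul1n addn0.
by rewrite big_nat_recr //= mulnAC IHl addnS factS mulnC.
Qed.

Lemma prime_ndvd_fact p m : prime p -> (m < p)%N -> ~~ (p %| m`!)%N.
Proof.
move=> p_pr lt_mp; rewrite fact_prod Euclid_dvd_prod // big_has_cond; apply/hasPn => i.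
by rewrite mem_index_iota => /andP[i0 im]; apply/negP => /(dvdn_leq i0); lia.
Qed.

Lemma bin_leq_expn n m : ('C(n, m) <= 2 ^ n)%N.
Proof.
elim: n m => [|n IHn] [|m] //=; first by rewrite bin0 expn_gt0.
by rewrite binS expnS mul2n -addnn leq_add.
Qed.

Lemma ln_pow_nat a k : (0 < a)%N -> ln (INR (a ^ k)) = INR k * ln (INR a).
Proof.
move=> a0; elim: k => [|k IHk]; first by rewrite expn0 /= ln_1; lra.
rewrite expnS INR_muln ln_mult; first by rewrite IHk S_INR; lra.
  exact: INR_gt0.
by apply: INR_gt0; rewrite expn_gt0 a0.
Qed.

(** Each of the [l] factors of [C(n+l, l) l!] is at most [n + l], and Stirling's bound removes
    [l!]. *)
Lemma ln_bin_le n l :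
  (0 < l)%N ->
  ln (INR 'C(n + l, l)) <= INR l * (ln (INR (n + l)) - ln (INR l) + 1).
Proof.
move=> l0; have C0 : 0 < INR 'C(n + l, l) by apply: INR_gt0; rewrite bin_gt0 leq_addl.
have f0 : 0 < INR l`! by exact/INR_gt0/fact_gt0.
suff : ln (INR 'C(n + l, l)) + ln (INR l`!) <= INR l * ln (INR (n + l)).
  by have := ln_fact_ge l; lra.
rewrite -ln_mult // -INR_muln -prod_shift_bin -ln_pow_nat ?addn_gt0 ?l0 ?orbT //.
apply: ln_INR_leq; rewrite -[X in (_ <= _ ^ X)%N](subn1 l.+1) -prod_nat_const_nat.
by rewrite !big_seq; apply: leq_prod => i; rewrite mem_index_iota leq_add2l => /andP[].
Qed.

(** Each prime is coprime to the product of the other, distinct ones, so Gauss's lemma applies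
    inductively. *)
Lemma prod_primes_dvd (s : seq nat) c :
  uniq s -> {in s, forall p, prime p && (p %| c)} -> (\prod_(p <- s) p %| c)%N.
Proof.
elim: s => [|p s IHs] /=; first by rewrite big_nil dvd1n.
case/andP=> p_s s_uniq s_c; rewrite big_cons.
have /andP[p_pr p_c] := s_c p (mem_head _ _).
have s_c' : {in s, forall q, prime q && (q %| c)}.
  by move=> q q_s; apply: s_c; rewrite inE q_s orbT.
rewrite Gauss_dvd ?p_c ?IHs // prime_coprime // Euclid_dvd_prod // big_has.
apply/hasPn => q q_s; have /andP[q_pr _] := s_c' _ q_s.
by rewrite dvdn_prime2 //; apply: contraNneq p_s => ->.
Qed.

Lemma sum_ln_primes_le (s : seq nat) c :
    (0 < c)%N -> uniq s -> {in s, forall p, prime p && (p %| c)} ->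
  \big[Rplus/0]_(p <- s) ln (INR p) <= ln (INR c).
Proof.
move=> c0 s_uniq s_c.
have -> : \big[Rplus/0]_(p <- s) ln (INR p) = ln (INR (\prod_(p <- s) p)).
  have : {in s, forall p, (0 < p)%N} by move=> p /s_c /andP[/prime_gt0].
  elim: s {s_uniq s_c} => [|p s IHs] s_pos; first by rewrite !big_nil /= ln_1.
  have s_pos' : {in s, forall p, (0 < p)%N} by move=> q q_s; apply: s_pos; rewrite inE q_s orbT.
  rewrite !big_cons INR_muln ln_mult ?IHs //; apply: INR_gt0; first exact/s_pos/mem_head.
  by rewrite big_seq prodn_cond_gt0.
exact/ln_INR_leq/dvdn_leq/prod_primes_dvd.
Qed.

(** * Chebyshev's upper bounds *)

Definition theta (n : nat) : R := \big[Rplus/0]_(p <- iota 1 n | prime p) ln (INR p).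

Lemma sum_ge0 (I : Type) (s : seq I) (P : pred I) (f : I -> R) :
  (forall i, P i -> 0 <= f i) -> 0 <= \big[Rplus/0]_(i <- s | P i) f i.
Proof.
by move=> f0; apply: big_ind => //; [exact: Rle_refl | move=> *; exact: Rplus_le_le_0_compat].
Qed.

Lemma theta_addn m k : theta (m + k) =
  theta m + \big[Rplus/0]_(p <- iota m.+1 k | prime p) ln (INR p).
Proof. by rewrite /theta iotaD big_cat add1n. Qed.

Lemma theta_leq m n : (m <= n)%N -> theta m <= theta n.
Proof.
move=> le_mn; rewrite -(subnKC le_mn) theta_addn.
suff : 0 <= \big[Rplus/0]_(p <- iota m.+1 (n - m) | prime p) ln (INR p) by lra.
by apply: sum_ge0 => p _; exact: ln_INR_ge0.
Qed.

(* Every prime of [(m, 2m]] divides the central binomial coefficient. *)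
Lemma theta_double m : theta (m + m) <= theta m + 2 * INR m.
Proof.
rewrite theta_addn; apply: Rplus_le_compat_l; rewrite -big_filter.
have bin0 : (0 < 'C(m + m, m))%N by rewrite bin_gt0 leq_addl.
apply: Rle_trans (sum_ln_primes_le _ _ bin0 _ _) _.
- by rewrite filter_uniq // iota_uniq.
- move=> p; rewrite mem_filter mem_iota => /andP[p_pr /andP[mp pm]].
  rewrite p_pr /=.
  have : (p %| (m + m)`!)%N by rewrite dvdn_fact // prime_gt0 //=; lia.
  rewrite -(bin_fact (leq_addl m m)) addnK !Euclid_dvdM //.
  by rewrite (negPf (prime_ndvd_fact _ _ p_pr mp)) !orbF.
apply: Rle_trans (ln_INR_leq _ _ (bin_leq_expn _ _)) _.
rewrite ln_pow_nat // INR_addn.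
have ln2 : ln (INR 2) <= 1 by have := ln_le_sub1 (INR 2) (INR_gt0 2 isT); rewrite /=; lra.
have := Rmult_le_compat_l _ _ _ (pos_INR m) ln2; lra.
Qed.

(** Strong induction by halving: with [m] half of [n] rounded up, [theta n <= 4m + 2m <= 3(n+1)],
    which is at most [4n] once [n >= 3]. *)
Lemma theta_le n : theta n <= 4 * INR n.
Proof.
have [k] := ubnP n; elim: k n => // k IHk n lt_nk.
have [n_small | n_big] := leqP n 2.
  case: n n_small {lt_nk} => [|[|[|//]]] _; rewrite /theta /= ?big_cons big_nil /=; try lra.
  have := ln_le_sub1 (INR 2) (INR_gt0 2 isT); rewrite /=; lra.
have [m le_nm le_mn] : exists2 m, (n <= m + m)%N & (m + m <= n + 1)%N.
  by exists (uphalf n); rewrite addnn; have := odd_double_half n; rewrite uphalf_half; lia.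
have m_lt_k : (m < k)%N by lia.
have := theta_leq _ _ le_nm; have := theta_double m; have := IHk _ m_lt_k.
have := INR_leq _ _ le_mn; have := INR_leq _ _ n_big; rewrite !INR_addn /=; lra.
Qed.

Definition prime_count (n : nat) : nat := count prime (iota 1 n).

(* [n ln n - ln n!] bounds the sum of [ln (n / p)] over the primes [p <= n]. *)
Lemma prime_count_ln_le n : INR (prime_count n) * ln (INR n) <= 5 * INR n.
Proof.
suff : INR (prime_count n) * ln (INR n) + ln (INR n`!) <= theta n + INR n * ln (INR n).
  by have := theta_le n; have := ln_fact_ge n; lra.
have -> : ln (INR n`!) = \big[Rplus/0]_(k <- iota 1 n) ln (INR k).
  elim: n => [|n IHn]; first by rewrite big_nil /= ln_1.
  rewrite -addn1 iotaD big_cat big_seq1 -IHn addn1 factS INR_muln ln_mult.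
  - by rewrite add1n /=; lra.
  - exact: INR_gt0.
  - exact/INR_gt0/fact_gt0.
(* Stated for arbitrary lists to allow induction: a prime adds the same amount to both sides, any
   other [k] adds [ln k] on the left and [ln n] on the right. *)
suff key (s : seq nat) : {in s, forall k, (k <= n)%N} ->
    INR (count prime s) * ln (INR n) + \big[Rplus/0]_(k <- s) ln (INR k) <=
    \big[Rplus/0]_(p <- s | prime p) ln (INR p) + INR (size s) * ln (INR n).
  by rewrite -[X in _ + INR X * _](size_iota 1 n); apply: key => k; rewrite mem_iota; lia.
elim: s => [|k s IHs] s_le; first by rewrite !big_nil /=; lra.
have s_le' : {in s, forall k, (k <= n)%N} by move=> q q_s; apply: s_le; rewrite inE q_s orbT.
have := ln_INR_leq _ _ (s_le k (mem_head _ _)).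
rewrite !big_cons [size _]/= [count _ _]/= S_INR INR_addn.
have := IHs s_le'; case: (prime k) => /=; lra.
Qed.

(** * Floors of real numbers *)

Lemma nfloor_unique x n : INR n <= x < INR n + 1 -> nfloor x = n.
Proof.
rewrite INR_IZR_INZ => -[le_nx lt_xn]; rewrite /nfloor -(Int_part_spec x (Z.of_nat n)); last lra.
exact: Nat2Z.id.
Qed.

Lemma nfloor_spec x : 0 <= x -> INR (nfloor x) <= x < INR (nfloor x) + 1.
Proof.
move=> x0; have [] := base_Int_part x; rewrite /nfloor => le_x gt_x.
rewrite INR_IZR_INZ Z2Nat.id; first lra.
suff : (-1 < Int_part x)%Z by lia.
apply: lt_IZR; lra.
Qed.

Lemma nfloor_le x y : 0 <= x <= y -> (nfloor x <= nfloor y)%N.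
Proof.
move=> xy; have := nfloor_spec x (proj1 xy); have := nfloor_spec y ltac:(lra) => fy fx.
rewrite leqNgt; apply/negP => /INR_leq; rewrite S_INR; lra.
Qed.

Lemma nfloor_divn y j : 0 <= y -> (0 < j)%N -> nfloor (y / INR j) = nfloor y %/ j.
Proof.
move=> y0 j0; have [le_y lt_y] := nfloor_spec y y0; have jR := INR_gt0 j j0.
apply: nfloor_unique; have := INR_leq _ _ (leq_trunc_div (nfloor y) j).
have := INR_leq _ _ (ltn_ceil (nfloor y) j0); rewrite !INR_muln !S_INR => lo hi.
have yE : y / INR j * INR j = y by field; lra.
split; [apply: (Rmult_le_reg_r (INR j)) | apply: (Rmult_lt_reg_r (INR j))] => //; lra.
Qed.

Lemma nfloor_INR_add m y : 0 <= y -> nfloor (INR m + y) = (m + nfloor y)%N.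
Proof. by move=> /nfloor_spec y0; apply: nfloor_unique; rewrite INR_addn; lra. Qed.

Lemma nfloor_INR m : nfloor (INR m) = m.
Proof. by apply: nfloor_unique; lra. Qed.

(** * Primes with a multiple in a short interval *)

(** The range of [p] depends on [N] only, so the sums over [j] and [p] can later be exchanged. *)
Lemma prime_countB c d N : (c <= d)%N -> (d <= N)%N ->
  (prime_count d - prime_count c =
   \sum_(1 <= p < N.+1 | prime p) (c < p <= d))%N.
Proof.
move=> le_cd le_dN; rewrite /prime_count -{1}(subnKC le_cd) iotaD count_cat addKn.
rewrite -sum1_count add1n -[(d - c)%N]subSS -/(index_iota c.+1 d.+1).
rewrite (big_nat_widenl _ 1) // (big_nat_widen _ _ N.+1) //.
rewrite big_mkcond [RHS]big_mkcond; apply: eq_bigr => p _ /=.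
by case: (prime p) => //=; rewrite ltnS; case: (_ < _)%N; case: (_ <= _)%N.
Qed.

Lemma sum_nat_window k c d : (\sum_(1 <= j < k) (c < j <= d) <= d - c)%N.
Proof.
rewrite -big_mkcond /= sum1_count -size_filter.
rewrite -[X in (_ <= X)%N](size_iota c.+1); apply: uniq_leq_size.
  by rewrite filter_uniq // iota_uniq.
by move=> j; rewrite mem_filter mem_iota; lia.
Qed.

(* Summing [b %/ p - a %/ p] counts the pairs (p, multiple of p in (a, b]),
   which makes the count additive over adjacent intervals. *)
Definition hits (n K N a b : nat) : nat :=
  (\sum_(1 <= p < N.+1 | prime p && (n < p * K)) (b %/ p - a %/ p))%N.

Lemma hitsD n K N a b c : (a <= b)%N -> (b <= c)%N ->
  hits n K N a c = (hits n K N a b + hits n K N b c)%N.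
Proof.
move=> le_ab le_bc; rewrite /hits -big_split /=; apply: eq_bigr => p _.
by rewrite addnC addnBA ?leq_div2r // subnK ?leq_div2r.
Qed.

(** The prime sum counts pairs [(j, p)] with [m < j p <= m + k] and [j <= k]. Summing over [j] first
    leaves at most the number of multiples of [p] in the window. *)
Lemma prime_sum_le_hits alpha n K N m :
    let k := nfloor (Rpower (INR m) alpha) in
    (n <= m)%N -> (k <= K)%N -> (m + k <= N)%N ->
  (prime_sum alpha m <= hits n K N m (m + k))%N.
Proof.
move=> k le_nm le_kK le_N; rewrite /prime_sum -/k.
have pow0 : 0 <= Rpower (INR m) alpha by exact/Rlt_le/exp_pos.
have -> : (\sum_(1 <= j < k.+1)
     (primepi (Rdiv (Rplus (INR m) (Rpower (INR m) alpha)) (INR j))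
      - primepi (Rdiv (INR m) (INR j))) =
   \sum_(1 <= j < k.+1) \sum_(1 <= p < N.+1 | prime p) (m %/ j < p <= (m + k) %/ j))%N.
  rewrite !big_seq; apply: eq_bigr => j; rewrite mem_index_iota => /andP[j0 _].
  rewrite /primepi !nfloor_divn //; try exact: pos_INR; last first.
    by apply: Rplus_le_le_0_compat => //; exact: pos_INR.
  rewrite nfloor_INR_add // nfloor_INR -/k; apply: prime_countB.
    by rewrite leq_div2r // leq_addr.
  exact: leq_trans (leq_div _ _) le_N.
rewrite exchange_big /hits [X in (_ <= X)%N]big_mkcondr /=; apply: leq_sum => p p_pr.
have p0 := prime_gt0 p_pr.
have -> : (\sum_(1 <= j < k.+1) (m %/ j < p <= (m + k) %/ j) =
           \sum_(1 <= j < k.+1) (m %/ p < j <= (m + k) %/ p))%N.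
  rewrite !big_seq; apply: eq_bigr => j; rewrite mem_index_iota => /andP[j0 _].
  by rewrite !ltn_divLR // !leq_divRL // mulnC.
case: ifP => [_ | /negbT]; first exact: sum_nat_window.
(* If [p K <= n], then [j p <= K p <= n <= m] for every admissible [j], so no multiple reaches the
   window. *)
rewrite -leqNgt => pK_le; rewrite big_seq big1 // => j.
rewrite mem_index_iota => /andP[_ le_jk].
rewrite ltn_divLR // ltnNge; suff -> : (j * p <= m)%N by [].
by apply: leq_trans le_nm; apply: leq_trans pK_le; rewrite mulnC leq_mul2l; lia.
Qed.

(** Adjacent windows [(m, m + k]] are laid from [n] onwards. Each has [k <= m^alpha], so the
    hypothesis gives at least [delta k] hits in it; only a last piece shorter than [K] is lost. *)
Lemma hits_ge alpha delta M n L :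
    0 <= alpha -> 0 < delta ->
    (forall m : nat, (M <= m)%N ->
      delta * Rpower (INR m) alpha <= INR (prime_sum alpha m)) ->
    (0 < n)%N -> (M <= n)%N ->
    let K := nfloor (Rpower (INR (n + L)) alpha) in
  delta * (INR L - INR K) <= INR (hits n K (n + L) n (n + L)).
Proof.
move=> a0 d0 sumP n0 le_Mn K.
(* [d] bounds the distance left to cover, which shrinks because [k] is positive. *)
suff key d m : (n <= m)%N -> (m <= n + L)%N -> (n + L - m < d)%N ->
    delta * (INR (n + L) - INR m - INR K) <= INR (hits n K (n + L) m (n + L)).
  by have := key (L.+1) n (leqnn _) (leq_addr _ _) ltac:(lia); rewrite INR_addn; lra.
elim: d m => // d IHd m le_nm le_mN lt_d.
have m1 : 1 <= INR m by apply: (INR_leq 1); exact: leq_trans n0 le_nm.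
have pow1 : 1 <= Rpower (INR m) alpha.
  by rewrite -(Rpower_O (INR m)); [apply: Rle_Rpower | ]; lra.
have pow0 : 0 <= Rpower (INR m) alpha by lra.
set k := nfloor (Rpower (INR m) alpha).
have [le_k lt_k] := nfloor_spec _ pow0.
have le_kK : (k <= K)%N.
  apply: nfloor_le; split=> //; apply: Rle_Rpower_l => //; split; [lra|exact: INR_leq].
have k0 : (0 < k)%N by rewrite -(nfloor_INR 1); apply: nfloor_le => /=; lra.
(* If the window overshoots, less than [K] is left and the claimed lower bound is negative. *)
have [le_N | gt_N] := leqP (m + k) (n + L); last first.
  have := pos_INR (hits n K (n + L) m (n + L)).
  have := INR_leq _ _ le_kK; have := INR_ltn _ _ gt_N; rewrite !INR_addn => *.
  by apply: Rle_trans (_ : delta * 0 <= _); [apply: Rmult_le_compat_l | ]; lra.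
rewrite (hitsD _ _ _ _ (m + k)) ?leq_addr // INR_addn.
have := INR_leq _ _ (prime_sum_le_hits alpha n K (n + L) m le_nm le_kK le_N).
have := sumP m (leq_trans le_Mn le_nm).
have := IHd (m + k)%N ltac:(lia) le_N ltac:(lia).
rewrite -/k !INR_addn; have := Rmult_le_compat_l _ _ _ (Rlt_le _ _ d0) le_k.
rewrite -/k; lra.
Qed.

(** From [K L <= n < p K] follows [p > L], so [p] has at most one multiple in [(n, n+L]]; if it has
    one, it divides the product. *)
Lemma hits_le n L K :
    (0 < n)%N -> (K * L <= n)%N ->
  (hits n K (n + L) n (n + L) <=
   count (fun p => n < p * K)%N
     [seq p <- primes (\prod_(1 <= i < L.+1) (n + i)) | (L < p)%N])%N.
Proof.
move=> n0 le_KL; set Q := (\prod_(1 <= i < L.+1) (n + i))%N.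
have Q0 : (0 < Q)%N by rewrite /Q prodn_gt0 // => i; rewrite addn_gt0 n0.
apply: (@leq_trans (\sum_(1 <= p < (n + L).+1 | prime p && (n < p * K) && (p %| Q)) 1)%N).
  rewrite [X in (_ <= X)%N]big_mkcondr /=; apply: leq_sum => p /andP[p_pr lt_pK].
  have p0 := prime_gt0 p_pr.
  have lt_Lp : (L < p)%N by move: le_KL lt_pK; nia.
  have le1 : ((n + L) %/ p <= (n %/ p).+1)%N.
    by rewrite -ltnS ltn_divLR // !mulSn; have := ltn_ceil n p0; rewrite mulSn; lia.
  case: ifP => [_ | /negP pNQ]; first lia.
  rewrite leqn0 subn_eq0 leqNgt; apply/negP => lt_div; case: pNQ.
  (* The quotient grows, so the largest multiple of [p] up to [n + L] exceeds [n] and is one of the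
     factors. *)
  rewrite Euclid_dvd_prod // big_has; apply/hasP; exists ((n + L) %/ p * p - n)%N.
    by rewrite mem_index_iota; have := leq_trunc_div (n + L) p; move: lt_div; rewrite ltn_divLR //; lia.
  by rewrite subnKC ?dvdn_mull //; move: lt_div; rewrite ltn_divLR //; lia.
rewrite sum1_count -!size_filter; apply: uniq_leq_size; first by rewrite filter_uniq // iota_uniq.
move=> p; rewrite !mem_filter mem_primes Q0 => /andP[/andP[/andP[p_pr lt_pK] pQ] _].
by rewrite lt_pK p_pr pQ /= andbT; move: le_KL lt_pK; nia.
Qed.

(** * Logarithms of the large prime divisors *)

(** A prime above [L] does not divide [L!], hence it divides the binomial coefficient. *)
Lemma sum_ln_primes_gt_le n L :
    (0 < L)%N ->
  \big[Rplus/0]_(p <- primes (\prod_(1 <= i < L.+1) (n + i)) | (L < p)%N) ln (INR p) <=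
  INR L * (ln (INR (n + L)) - ln (INR L) + 1).
Proof.
move=> L0; apply: Rle_trans (ln_bin_le n L L0); rewrite -big_filter.
apply: sum_ln_primes_le; first by rewrite bin_gt0 leq_addl.
  by rewrite filter_uniq // primes_uniq.
move=> p; rewrite mem_filter prod_shift_bin mem_primes => /andP[lt_Lp /and3P[p_pr _]].
by rewrite Euclid_dvdM // p_pr (negPf (prime_ndvd_fact _ _ p_pr lt_Lp)) orbF.
Qed.

Lemma sum_ln_ge u a e (s : seq nat) (P Q : pred nat) :
    {in s, forall p, u + a * INR (P p) + e * INR (Q p) <= ln (INR p)} ->
  u * INR (size s) + a * INR (count P s) + e * INR (count Q s) <=
  \big[Rplus/0]_(p <- s) ln (INR p).
Proof.
elim: s => [|p s IHs] s_ge; first by rewrite big_nil /=; lra.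
have := IHs (fun q q_s => s_ge q (@mem_behead _ (p :: s) q q_s)).
have := s_ge p (mem_head _ _).
rewrite big_cons -[size (_ :: _)]/(size s).+1 -[count P (_ :: _)]/(P p + count P s)%N.
rewrite -[count Q (_ :: _)]/(Q p + count Q s)%N S_INR !INR_addn; lra.
Qed.

Lemma omega_le_count Q Y :
  (omega Q <= count (fun p => Y < p)%N (primes Q) + prime_count Y)%N.
Proof.
rewrite /omega -(count_predC (fun p => Y < p)%N) leq_add2l /prime_count -!size_filter.
apply: uniq_leq_size; first by rewrite filter_uniq // primes_uniq.
move=> p; rewrite !mem_filter mem_iota mem_primes /= -leqNgt => /andP[le_pY /and3P[p_pr _ _]].
by rewrite p_pr prime_gt0 //= add1n ltnS.
Qed.

Lemma ln_gt_ge n p K : (0 < n)%N -> (n < p * K)%N -> ln (INR n) - ln (INR K) <= ln (INR p).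
Proof.
move=> n0 lt_n; have /andP[p0 K0] : (0 < p)%N && (0 < K)%N by rewrite -muln_gt0; lia.
have := ln_INR_leq _ _ (ltnW lt_n); rewrite INR_muln ln_mult; try exact: INR_gt0; lra.
Qed.

(** Every prime counted by [hits] exceeds [n / K]. As nothing is assumed on [omega], the bound
    constrains [delta] itself. *)
Lemma hits_ln_le n L K :
    (0 < n)%N -> (0 < L)%N -> (K * L <= n)%N ->
  (ln (INR n) - ln (INR K)) * INR (hits n K (n + L) n (n + L)) <=
  INR L * (ln (INR (n + L)) - ln (INR L) + 1).
Proof.
move=> n0 L0 le_KL; apply: Rle_trans (sum_ln_primes_gt_le n L L0); rewrite -big_filter.
set s := [seq _ <- _ | _]; set e := ln _ - ln _.
have e0 : 0 <= e.
  suff : ln (INR K) <= ln (INR n) by rewrite /e; lra.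
  by apply: ln_INR_leq; apply: leq_trans le_KL; rewrite leq_pmulr.
have := sum_ln_ge 0 0 e s predT (fun p => n < p * K)%N.
have := INR_leq _ _ (hits_le n L K n0 le_KL); rewrite -/s => /(Rmult_le_compat_l e _ _ e0) h1 h2.
suff : {in s, forall p, 0 + 0 * INR (predT p) + e * INR (n < p * K)%N <= ln (INR p)}.
  by move=> /h2; lra.
move=> p _; case: ltnP => [/(ln_gt_ge _ _ _ n0) | _] /=; rewrite -/e; first lra.
have := ln_INR_ge0 p; lra.
Qed.

(* The logarithms of the large prime divisors are split into three layers:
   all exceed [ln L], those beyond [A * L] gain [ln A], and those counted by
   [hits] are of size at least [n / K]. *)
Lemma omega_ge_bound n L K A :
    (0 < n)%N -> (0 < L)%N -> (0 < A)%N -> (0 < K)%N -> (K * (A * L) <= n)%N ->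
    (L <= omega (\prod_(1 <= i < L.+1) (n + i)))%N ->
  ln (INR L) * (INR L - INR (prime_count L)) +
  ln (INR A) * (INR L - INR (prime_count (A * L))) +
  (ln (INR n) - ln (INR K) - ln (INR L) - ln (INR A)) *
    INR (hits n K (n + L) n (n + L)) <=
  INR L * (ln (INR (n + L)) - ln (INR L) + 1).
Proof.
move=> n0 L0 A0 K0 le_KAL le_L_omega.
apply: Rle_trans (sum_ln_primes_gt_le n L L0); rewrite -big_filter.
set Q := (\prod_(1 <= i < L.+1) (n + i))%N in le_L_omega *.
set s := [seq _ <- _ | _]; set e := _ - ln (INR A).
have lnAL : ln (INR (A * L)) = ln (INR A) + ln (INR L).
  by rewrite INR_muln ln_mult //; exact: INR_gt0.
have le_L_AL : (L <= A * L)%N by rewrite leq_pmull.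
have e0 : 0 <= e.
  have := ln_INR_leq _ _ le_KAL; rewrite INR_muln ln_mult ?lnAL /e; first lra.
    exact: INR_gt0.
  by apply: INR_gt0; rewrite muln_gt0 A0.
have := sum_ln_ge (ln (INR L)) (ln (INR A)) e s (fun p => A * L < p)%N (fun p => n < p * K)%N.
have le_KL : (K * L <= n)%N by apply: leq_trans le_KAL; rewrite leq_mul2l le_L_AL orbT.
have := INR_leq _ _ (hits_le n L K n0 le_KL); rewrite -/Q -/s => /(Rmult_le_compat_l e _ _ e0) h1 h2.
have size_s : (L <= size s + prime_count L)%N.
  by apply: leq_trans le_L_omega _; rewrite size_filter omega_le_count.
have count_s : (L <= count (fun p => A * L < p)%N s + prime_count (A * L))%N.
  apply: leq_trans le_L_omega _; apply: leq_trans (omega_le_count _ (A * L)) _.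
  rewrite leq_add2r count_filter; apply: sub_count => p /= lt_p.
  by apply/andP; split; [|exact: leq_ltn_trans lt_p].
have := INR_leq _ _ size_s; have := INR_leq _ _ count_s; rewrite !INR_addn => h3 h4.
have {}h3 : INR L - INR (prime_count (A * L)) <= INR (count (fun p => A * L < p)%N s) by lra.
have {}h4 : INR L - INR (prime_count L) <= INR (size s) by lra.
have := Rmult_le_compat_l _ _ _ (ln_INR_ge0 A) h3.
have := Rmult_le_compat_l _ _ _ (ln_INR_ge0 L) h4.
suff /h2 : {in s, forall p, ln (INR L) + ln (INR A) * INR (A * L < p)%N +
                      e * INR (n < p * K)%N <= ln (INR p)} by lra.
move=> p; rewrite mem_filter => /andP[/ltnW/ln_INR_leq le_Lp _].
case: (ltnP n (p * K)) => [lt_n | _].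
  (* The layers are nested, and in the top one the three gains add up to [ln n - ln K]. *)
  have -> : (A * L < p)%N by move: le_KAL lt_n; nia.
  by have := ln_gt_ge _ _ _ n0 lt_n; rewrite /e /=; lra.
by case: ltnP => [/ltnW/ln_INR_leq | _] /=; rewrite ?lnAL; lra.
Qed.

(** * Sizes of the parameters for large [n] *)

(** Squaring [exp (c x / 2) >= c x / 2] gives [exp (c x) >= c^2 x^2 / 4], which is at least [D x]
    from [4 D / c^2] on. *)
Lemma linear_le_exp c D : 0 < c -> 0 <= D ->
  exists X, forall x, X <= x -> D * x <= exp (c * x).
Proof.
move=> c0 D0; exists (4 * D / (c * c)) => x Xx.
have cc0 : 0 < c * c by nra.
have X0 : 0 <= 4 * D / (c * c) by apply: Rmult_le_pos; [lra | apply/Rlt_le/Rinv_0_lt_compat].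
have : 4 * D <= c * c * x.
  have := Rmult_le_compat_l _ _ _ (Rlt_le _ _ cc0) Xx.
  by rewrite (_ : c * c * (4 * D / (c * c)) = 4 * D); [lra | field; lra].
have -> : c * x = c * x / 2 + c * x / 2 by field.
rewrite exp_plus; have := exp_ineq1_le (c * x / 2).
have : 0 <= c * x / 2 by nra.
set y := c * x / 2 => y0 ey Dx.
have : y * y <= exp y * exp y by apply: Rmult_le_compat; lra.
suff : D * x <= y * y by lra.
rewrite (_ : y * y = (c * c * x) * x / 4); last by rewrite /y; field.
nra.
Qed.

Lemma exp1_ge2 : 2 <= exp 1.
Proof. by have := exp_ineq1_le 1; lra. Qed.

Lemma exp_le x y : x <= y -> exp x <= exp y.
Proof. by case=> [/exp_increasing/Rlt_le | ->] //; exact: Rle_refl. Qed.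

(** Intended for [L] near [n^beta] and [K] near [(n+L)^alpha]. The additive 1 in the logarithmic
    bounds absorbs floors and the shift from [n] to [n + L]; [C] is a free threshold. *)
Record scales (alpha beta C : R) (A n L K : nat) : Prop := Scales {
  scales_n : (0 < n)%N;
  scales_L : (0 < L)%N;
  scales_lnL : beta * ln (INR n) - 1 <= ln (INR L);
  scales_C : C <= ln (INR L);
  scales_lnD : ln (INR (n + L)) <= ln (INR n) + 1;
  scales_K : (0 < K)%N;
  scales_lnK : ln (INR K) <= alpha * ln (INR n) + 1;
  scales_KAL : (K * (A * L) <= n)%N;
  scales_xK : ln (INR n) * INR K <= INR L }.

Lemma eventually_scales alpha beta C A :
    0 < alpha -> alpha < beta -> beta <= 1 / 2 -> (0 < A)%N ->
  exists X, forall n, X <= ln (INR n) ->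
    let L := nfloor (Rpower (INR n) beta) in
    let K := nfloor (Rpower (INR (n + L)) alpha) in
    scales alpha beta C A n L K.
Proof.
move=> a0 lt_ab b2 A0.
(* [X1] serves [K ln n <= L]: the factor [e^2] pays for [K <= e n^alpha] and [L >= n^beta / e]. *)
have [X1 domX1] := linear_le_exp (beta - alpha) (exp 2) ltac:(lra) (Rlt_le _ _ (exp_pos 2)).
have c0 : 0 < 1 - alpha - beta by lra.
(* [X2] serves [K A L <= n], possible since [alpha + beta < 1]; [X3] serves [C <= ln L]. *)
pose X2 := (ln (INR A) + 1) / (1 - alpha - beta); pose X3 := (Rabs C + 1) / beta.
exists (Rmax (Rmax 1 X1) (Rmax X2 X3)) => n Xx L K.
move: Xx; set x := ln (INR n) => Xx.
have [x1 xX1 xX2 xX3] : [/\ 1 <= x, X1 <= x, X2 <= x & X3 <= x].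
  have := Rmax_l 1 X1; have := Rmax_r 1 X1; have := Rmax_l X2 X3; have := Rmax_r X2 X3.
  have := Rmax_l (Rmax 1 X1) (Rmax X2 X3); have := Rmax_r (Rmax 1 X1) (Rmax X2 X3).
  by split; lra.
have {}xX2 : ln (INR A) + 1 <= (1 - alpha - beta) * x.
  have := Rmult_le_compat_l _ _ _ (Rlt_le _ _ c0) xX2.
  by rewrite (_ : _ * X2 = ln (INR A) + 1) // /X2; field; lra.
have {}xX3 : Rabs C + 1 <= beta * x.
  have := Rmult_le_compat_l beta _ _ ltac:(lra) xX3.
  by rewrite (_ : _ * X3 = Rabs C + 1) // /X3; field; lra.
have n0 : (0 < n)%N by rewrite lt0n; apply/eqP => n_eq0; move: x1; rewrite /x n_eq0 ln_0; lra.
have nR := INR_gt0 _ n0.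
have expx : exp x = INR n by rewrite /x exp_ln.
(* With [n^beta >= 2] the floor costs at most a factor 2, hence at most [e]. *)
have ebx : 2 <= exp (beta * x).
  by have := Rabs_pos C; have := exp_ineq1_le (beta * x); lra.
have [le_L lt_L] := nfloor_spec (Rpower (INR n) beta) (Rlt_le _ _ (exp_pos _)).
rewrite -/L /Rpower -/x in le_L lt_L.
have L_exp : exp (beta * x - 1) <= INR L.
  have := exp1_ge2; have := exp_pos (beta * x - 1).
  have : exp (beta * x) = exp (beta * x - 1) * exp 1 by rewrite -exp_plus; congr exp; lra.
  by nra.
have L0R : 0 < INR L by have := exp_pos (beta * x - 1); lra.
have L0 : (0 < L)%N by rewrite lt0n; apply/eqP => L0; move: L0R; rewrite L0 /=; lra.
have lnL : beta * x - 1 <= ln (INR L).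
  by rewrite -[X in X <= _]ln_exp; apply: ln_le => //; exact: exp_pos.
have le_Ln : INR L <= INR n.
  by rewrite -expx; apply: Rle_trans le_L _; apply: exp_le; nra.
have lnD : ln (INR (n + L)) <= x + 1.
  rewrite -[X in _ <= X]ln_exp exp_plus expx; apply: ln_le.
    by rewrite INR_addn; lra.
  by rewrite INR_addn; have := exp1_ge2; nra.
have [le_K lt_K] := nfloor_spec (Rpower (INR (n + L)) alpha) (Rlt_le _ _ (exp_pos _)).
rewrite -/K /Rpower in le_K lt_K.
have lnD0 : 0 <= ln (INR (n + L)) by exact: ln_INR_ge0.
have K0 : (0 < K)%N.
  rewrite lt0n; apply/eqP => K0; move: lt_K; rewrite K0 /=.
  have := exp_ineq1_le (alpha * ln (INR (n + L))); nra.
have K_exp : INR K <= exp (alpha * x + 1).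
  by apply: Rle_trans le_K _; apply: exp_le; nra.
have lnK : ln (INR K) <= alpha * x + 1.
  by rewrite -[X in _ <= X]ln_exp; apply: ln_le => //; exact: INR_gt0.
split=> //.
- by have := Rle_abs C; lra.
- apply/leP/INR_le; rewrite !INR_muln -expx.
  have AR := INR_gt0 _ A0.
  apply: (Rle_trans _ (exp (alpha * x + 1) * (INR A * exp (beta * x)))).
    apply: Rmult_le_compat => //; try exact: pos_INR.
      by apply: Rmult_le_pos; lra.
    by apply: Rmult_le_compat_l; lra.
  rewrite -[X in _ * (X * _)]exp_ln // -!exp_plus; apply: exp_le; nra.
- have := domX1 _ xX1.
  have -> : exp ((beta - alpha) * x) = exp (beta * x - 1) * exp (1 - alpha * x).
    by rewrite -exp_plus; congr exp; lra.
  have e1 : exp 2 = exp (alpha * x + 1) * exp (1 - alpha * x).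
    by rewrite -exp_plus; congr exp; lra.
  rewrite e1 (_ : _ * _ * x = x * exp (alpha * x + 1) * exp (1 - alpha * x)); last by lra.
  move=> /(Rmult_le_reg_r _ _ _ (exp_pos _)) le_x.
  apply: Rle_trans (_ : x * exp (alpha * x + 1) <= _); last by lra.
  by rewrite -/x; apply: Rmult_le_compat_l; lra.
Qed.

(** * Comparison of the estimates as [n] grows *)

Section Asymptotics.

Variables (alpha delta : R) (M : nat).
Hypotheses (alpha_gt0 : 0 < alpha) (alpha_lt : alpha < 1 / 2) (delta_gt0 : 0 < delta).
Hypothesis prime_sum_ge : forall m : nat, (M <= m)%N ->
  delta * Rpower (INR m) alpha <= INR (prime_sum alpha m).

(* Already the primes counted by [hits] force this: take [L = n^(1/2)]. *)
Lemma density_le : delta * (1 - alpha) <= 1 / 2.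
Proof.
have [le_d | gt_d] := Rle_lt_dec (delta * (1 - alpha)) (1 / 2); first by [].
have [X scX] := eventually_scales alpha (1 / 2) 0 1 alpha_gt0 alpha_lt (Rle_refl _) isT.
pose c := delta * (1 - alpha) - 1 / 2; have c0 : 0 < c by rewrite /c; lra.
(* [M.+1] puts [n] beyond [M], and the last entry beats the constant [3 + 2 * delta] of [h5]. *)
pose Y := Rmax X (Rmax (ln (INR M.+1)) ((4 + 2 * delta) / c)).
have [XY MY cY] : [/\ X <= Y, ln (INR M.+1) <= Y & (4 + 2 * delta) / c <= Y].
  have := Rmax_l X (Rmax (ln (INR M.+1)) ((4 + 2 * delta) / c)).
  have := Rmax_r X (Rmax (ln (INR M.+1)) ((4 + 2 * delta) / c)).
  have := Rmax_l (ln (INR M.+1)) ((4 + 2 * delta) / c).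
  have := Rmax_r (ln (INR M.+1)) ((4 + 2 * delta) / c).
  by rewrite -/Y; split; lra.
pose n := (nfloor (exp Y)).+1.
have Yn : Y <= ln (INR n).
  rewrite -[X in X <= _]ln_exp; apply: ln_le; first exact: exp_pos.
  by rewrite S_INR; have := nfloor_spec (exp Y) (Rlt_le _ _ (exp_pos _)); lra.
have le_Mn : (M <= n)%N.
  rewrite leqNgt; apply/negP => lt_nM.
  have : INR n < INR M.+1 by apply: INR_ltn; apply: leq_trans lt_nM _.
  by move=> /(ln_increasing _ _ (INR_gt0 n isT)); lra.
pose L := nfloor (Rpower (INR n) (1 / 2)).
pose K := nfloor (Rpower (INR (n + L)) alpha).
have [] : scales alpha (1 / 2) 0 1 n L K by apply: scX; lra.
move=> n0 L0 lnL _ lnD K0 lnK; rewrite mul1n => le_KL le_xK.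
have := hits_ln_le n L K n0 L0 le_KL.
have : delta * (INR L - INR K) <= INR (hits n K (n + L) n (n + L)).
  by apply: (hits_ge alpha delta M) => //; lra.
set G := INR (hits _ _ _ _ _); set x := ln (INR n) in Yn lnL lnD lnK le_xK *.
set l := ln (INR L) in lnL *; set k := ln (INR K) in lnK *.
have LR := INR_gt0 _ L0; have KR := INR_gt0 _ K0.
have k0 : 0 <= k by exact: ln_INR_ge0.
have kx : k <= x.
  by apply: ln_INR_leq; apply: leq_trans le_KL; rewrite leq_pmulr.
move=> G_ge G_le.
have h1 : (x - k) * (delta * (INR L - INR K)) <= INR L * (x + 2 - l).
  apply: Rle_trans (_ : (x - k) * G <= _); first by apply: Rmult_le_compat_l; lra.
  by apply: Rle_trans G_le _; apply: Rmult_le_compat_l; lra.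
have h2 : (x - k) * (delta * INR K) <= delta * INR L.
  apply: Rle_trans (_ : delta * (x * INR K) <= _); last by apply: Rmult_le_compat_l; lra.
  by rewrite (_ : (x - k) * (delta * INR K) = delta * ((x - k) * INR K)); [
     apply: Rmult_le_compat_l; nra | ring].
have h3 : (x - k) * delta <= x + 2 - l + delta.
  apply: (Rmult_le_reg_l (INR L)) => //; nra.
have h4 : ((1 - alpha) * x - 1) * delta <= (x - k) * delta.
  by apply: Rmult_le_compat_r; lra.
have h5 : c * x <= 3 + 2 * delta by rewrite /c; lra.
have : c * ((4 + 2 * delta) / c) <= c * x by apply: Rmult_le_compat_l; lra.
rewrite (_ : c * ((4 + 2 * delta) / c) = 4 + 2 * delta); [lra | field; lra].
Qed.

Lemma delta_lt1 : delta < 1.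
Proof. have := density_le; nra. Qed.

(** The exponent balancing the multiples of [L ln n] in [omega_ge_bound]: [gamma + delta (1 - alpha
    - gamma) = 1 - gamma]. *)
Let gamma := (1 - delta * (1 - alpha)) / (2 - delta).

Lemma gammaE : gamma * (2 - delta) = 1 - delta * (1 - alpha).
Proof. by have d1 := delta_lt1; rewrite /gamma; field; lra. Qed.

(** Clearing the denominator, this is [(1 - delta) (1 - 2 alpha) > 0]. *)
Lemma alpha_lt_gamma : alpha < gamma.
Proof. have := gammaE; have := delta_lt1; nra. Qed.

(** Clearing the denominator, this is [delta (1 - 2 alpha) > 0]. *)
Lemma gamma_lt_half : gamma < 1 / 2.
Proof. have := gammaE; have := delta_lt1; nra. Qed.

Lemma eventually_omega_lt : exists N : nat, forall n : nat, (N <= n)%N ->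
  let L := nfloor (Rpower (INR n) gamma) in
  (0 < n)%N /\ (0 < L)%N /\ (omega (\prod_(1 <= i < L.+1) (n + i)) < L)%N.
Proof.
have d1 := delta_lt1; have ltag := alpha_lt_gamma; have g2 := gamma_lt_half.
(* The final comparison yields [(1 - delta) ln A <= 11], which 13 contradicts. *)
pose A := (nfloor (exp (13 / (1 - delta)))).+1.
have lnA : 13 <= (1 - delta) * ln (INR A).
  have : 13 / (1 - delta) <= ln (INR A).
    rewrite -[X in X <= _]ln_exp; apply: ln_le; first exact: exp_pos.
    by rewrite S_INR; have := nfloor_spec (exp (13 / (1 - delta))) (Rlt_le _ _ (exp_pos _)); lra.
  move=> /(Rmult_le_compat_l (1 - delta) _ _ ltac:(lra)).
  by rewrite (_ : _ * (13 / _) = 13) //; field; lra.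
have [X scX] := eventually_scales alpha gamma (5 * INR A * ln (INR A) + 1) A
  alpha_gt0 ltag (Rlt_le _ _ g2) isT.
exists (maxn M (nfloor (exp X)).+1) => n; rewrite geq_max => /andP[le_Mn le_Xn].
have Xn : X <= ln (INR n).
  rewrite -[X in X <= _]ln_exp; apply: ln_le; first exact: exp_pos.
  have := INR_leq _ _ le_Xn; rewrite S_INR.
  by have := nfloor_spec (exp X) (Rlt_le _ _ (exp_pos _)); lra.
set L := nfloor (Rpower (INR n) gamma).
pose K := nfloor (Rpower (INR (n + L)) alpha).
have [] : scales alpha gamma (5 * INR A * ln (INR A) + 1) A n L K by apply: scX; lra.
move=> n0 L0 lnL C_L lnD K0 lnK le_KAL le_xK; do 2 split => //.
rewrite ltnNge; apply/negP => le_L_omega.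
have := omega_ge_bound n L K A n0 L0 isT K0 le_KAL le_L_omega.
have : delta * (INR L - INR K) <= INR (hits n K (n + L) n (n + L)).
  by apply: (hits_ge alpha delta M) => //; lra.
have AL0 : (0 < A * L)%N by rewrite muln_gt0.
have ln_AL : ln (INR (A * L)) = ln (INR A) + ln (INR L).
  by rewrite INR_muln ln_mult //; exact: INR_gt0.
have := prime_count_ln_le L; have := prime_count_ln_le (A * L); rewrite ln_AL INR_muln.
have := ln_INR_leq _ _ le_KAL; rewrite INR_muln ln_mult ?ln_AL; try exact: INR_gt0.
set G := INR (hits _ _ _ _ _); set x := ln (INR n) in Xn lnL lnD lnK le_xK *.
set l := ln (INR L) in lnL C_L *; set k := ln (INR K) in lnK *.
set a := ln (INR A) in lnA C_L *; set p1 := INR (prime_count L).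
set p2 := INR (prime_count _).
have [LR KR AR] : [/\ 0 < INR L, 0 < INR K & 0 < INR A] by split; exact: INR_gt0.
have [k0 l0 a0] : [/\ 0 <= k, 0 <= l & 0 <= a] by split; exact: ln_INR_ge0.
have [p10 p20] : 0 <= p1 /\ 0 <= p2 by split; exact: pos_INR.
move=> sum_le p2_le p1_le G_ge main.
(* Chebyshev gives [p2 l <= 5 A L], and the threshold on [l] exceeds [5 A a]; its extra 1 makes [l]
   positive. *)
have h1 : a * p2 <= INR L.
  have l1 : 0 < l by nra.
  apply: (Rmult_le_reg_l l) => //.
  apply: Rle_trans (_ : a * (5 * (INR A * INR L)) <= _).
    rewrite (_ : l * (a * p2) = a * (p2 * l)); last by ring.
    by apply: Rmult_le_compat_l => //; nra.
  rewrite (_ : a * (5 * (INR A * INR L)) = 5 * INR A * a * INR L); last by ring.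
  by apply: Rmult_le_compat_r; lra.
have e0 : 0 <= x - k - l - a by lra.
have h2 : (x - k - l - a) * (delta * (INR L - INR K)) <= (x - k - l - a) * G.
  exact: Rmult_le_compat_l.
have h3 : (x - k - l - a) * (delta * INR K) <= INR L.
  apply: Rle_trans (_ : x * INR K <= _); last by [].
  apply: Rle_trans (_ : x * (delta * INR K) <= _).
    by apply: Rmult_le_compat_r; [nra | lra].
  by apply: Rmult_le_compat_l; [lra | nra].
have h4 : INR L * (ln (INR (n + L)) - l + 1) <= INR L * (x + 2 - l).
  by apply: Rmult_le_compat_l; lra.
(* The losses are [5 L] from primes up to [L], [L] from [h1] and [L] from [h3], whence 7 after
   division by [L]. *)
have h5 : l + a - 7 + (x - k - l - a) * delta <= x + 2 - l.
  by apply: (Rmult_le_reg_l (INR L)) => //; lra.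
have h6 : ((1 - alpha) * x - 1 - l - a) * delta <= (x - k - l - a) * delta.
  by apply: Rmult_le_compat_r; lra.
have h7 : (2 - delta) * (gamma * x - 1) <= (2 - delta) * l by apply: Rmult_le_compat_l; lra.
have h8 : (2 - delta) * (gamma * x) = (1 - delta * (1 - alpha)) * x.
  by rewrite -gammaE; ring.
lra.
Qed.

End Asymptotics.

(** * From the failure at [L] to the value of [g_1] *)

(** The condition is decidable, holds for 1, and fails from [L] on, so a largest admissible value
    exists below [L]. *)
Lemma g1_exists n L :
    (0 < n)%N -> (omega (\prod_(1 <= i < L.+1) (n + i)) < L)%N ->
  exists2 k, is_g1 n k & (k < L)%N.
Proof.
move=> n0 omega_lt; pose P k := (0 < k)%N && [forall l : 'I_k.+1, (0 < l)%N ==>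
  (l <= omega (\prod_(1 <= i < l.+1) (n + i)))%N].
have PP k : reflect ((1 <= k)%N /\ g1_cond n k) (P k).
  apply: (iffP andP) => -[k0 g1k]; split=> //.
    move=> l l0 le_lk; move/forallP: g1k => /(_ (Ordinal (n:=k.+1) (m:=l) le_lk)).
    by move=> /implyP; exact.
  by apply/forallP => l; apply/implyP => l0; apply: g1k; rewrite // -ltnS.
have P1 : exists k, P k.
  (* Since [n + 1 > 1], its least prime divisor shows [omega (n + 1) >= 1]. *)
  exists 1%N; apply/PP; split=> // l l0 l1; have -> : l = 1%N by lia.
  rewrite big_nat1 /omega lt0n size_eq0; apply/eqP => pr0.
  have : pdiv (n + 1) \in primes (n + 1).
    by rewrite mem_primes pdiv_prime ?pdiv_dvd ?addn1.
  by rewrite pr0.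
have P_lt k : P k -> (k < L)%N.
  move=> /PP[_ g1k]; rewrite ltnNge; apply/negP => le_Lk.
  have L0 : (0 < L)%N by apply: leq_ltn_trans omega_lt.
  by have := g1k L L0 le_Lk; rewrite leqNgt omega_lt.
have P_le k : P k -> (k <= L)%N by move=> /P_lt/ltnW.
case: (ex_maxnP P1 P_le) => k Pk k_max; exists k; last exact: P_lt.
have [k0 g1k] := PP _ Pk; do 2 split=> //.
by move=> k' k'0 g1k'; apply: k_max; apply/PP.
Qed.

Theorem theorem1p4 (alpha delta : R) :
  0 < alpha -> alpha < 1 / 2 -> 0 < delta ->
  (exists M : nat, forall m : nat, (M <= m)%N ->
     delta * Rpower (INR m) alpha <= INR (prime_sum alpha m)) ->
  let gamma := Rmax alpha ((1 - delta * (1 - alpha)) / (2 - delta)) in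
  gamma < 1 / 2 /\
  (exists N : nat, forall n : nat, (N <= n)%N ->
     exists k : nat, is_g1 n k /\ INR k < Rpower (INR n) gamma).
Proof.
move=> a0 a2 d0 [M sumP]; cbv zeta.
have gt_a := alpha_lt_gamma _ _ _ a0 a2 d0 sumP.
rewrite Rmax_right; last exact: Rlt_le.
split; first exact: gamma_lt_half a0 a2 d0 sumP.
have [N omegaN] := eventually_omega_lt _ _ _ a0 a2 d0 sumP.
exists N => n /omegaN[n0 [L0 omega_lt]].
have [k g1k lt_kL] := g1_exists _ _ n0 omega_lt; exists k; split=> //.
apply: Rlt_le_trans (INR_ltn _ _ lt_kL) _.
exact: proj1 (nfloor_spec _ (Rlt_le _ _ (exp_pos _))).
Qed.
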